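(* Consider the regularized minimum distance (RMD) estimator $\hat\theta$ described in the context, in the linear case $g(\theta)=G\theta+g(0)$. Assume that Conditions L, DM, LID and ELM are satisfied and that $\lambda\le\ell_n/\sqrt n$. Then with probability at least $1-\alpha-\delta_n$: in the case of LID(a) (exactly sparse model), $$\|\hat\theta-\theta_0\|_q\le\frac{\ell_n(K+2)s^{1/q}}{\mu_n\sqrt n},\qquad q\in\{1,2\};$$ and, as long as $a>1$ and $A>n^{-1/2}\ell_n(K+1)$, in the case of LID(b) (approximately sparse model), $$\|\hat\theta-\theta_0\|_q\le\frac{C_{a,q}(L_n+\mu_n)\ell_n(K+2)s^{1/q}}{\mu_n\sqrt n},\qquad q\in\{1,2\},$$ where $C_{a,q}$ is a constant depending only on $a$ and $q$.
   Context: Setting. $\Theta\subset\mathbb R^p$, $g:\Theta\to\mathbb R^m$ is a target moment function, $\hat g:\Theta\to\mathbb R^m$ is its (random) empirical version, and $\theta_0\in\Theta$ is the unique solution of $g(\theta_0)=0$. $[k]=\{1,\dots,k\}$. In the linear case $g(\theta)=G\theta+g(0)$ with $G$ an $m\times p$ matrix with rows $G_j$. Constants: $\alpha\in(0,1)$, $\lambda>0$, $\delta_n>0$, $\ell_n\ge1$, $L_n\ge1$, $\mu_n>0$, $K>0$; $n$ is the sample size. The restricted set is $\mathcal R(\theta_0)=\{\theta\in\Theta:\|\theta\|_1\le\|\theta_0\|_1\}$. RMD estimator: $\hat\theta$ is a solution of $\min_{\theta\in\Theta}\|\theta\|_1$ subject to $\|\hat g(\theta)\|_\infty\le\lambda$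 (an arbitrary element of $\Theta$ if the constraint set is empty). Condition L: $\|\hat g(\theta_0)\|_\infty\le\lambda$ with probability at least $1-\alpha$. Condition DM: $\|\theta_0\|_1\le K$. Condition ELM: $\hat g(\theta)=\hat G\theta+\hat g(0)$, and with probability at least $1-\delta_n$, $\max_{j\in[m]}\|\hat G_j-G_j\|_\infty\vee\|\hat g(0)-g(0)\|_\infty\le\ell_n/\sqrt n$. Condition ES: there is $T\subset\{1,\dots,p\}$ with $|T|=s$ such that $\theta_{0j}\ne0$ only for $j\in T$. Condition AS: for some $A>0$, $a>1/2$, the non-increasing rearrangement of $(|\theta_{0j}|)_{j\in[p]}$ obeys $|\theta_0|_j^*\le Aj^{-a}$, $j\in[p]$. Identifiability factor: for $\eta\in\mathbb R^p$, with $\mathcal R(\eta)=\{\theta\in\Theta:\|\theta\|_1\le\|\eta\|_1\}$, $$k(\eta,\ell_q)=\inf_{\theta\in\mathcal R(\eta):\|\theta-\eta\|_q>0}\|G(\theta-\eta)\|_\infty/\|\theta-\eta\|_q.$$ Sparsification (components of $\theta_0$ ordered so that $|\theta_{01}|\ge\dots\ge|\theta_{0p}|$, which is without loss of generality): for $0<\epsilon<A$, $s=\lceil(A/\epsilon)^{1/a}\rceil$ and $\Delta=\sum_{j=1}^p|\theta_{0j}|1\{Aj^{-a}\le\epsilon\}$, let $\theta_0(\epsilon)$ have components $\theta_{0j}(\epsilon)=\theta_{0j}+\mathrm{sign}(\theta_{0j})\Delta/(s-1)$ if $Aj^{-a}>\epsilon$ and $\theta_{0j}(\epsilon)=0$ if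 $Aj^{-a}\le\epsilon$. Condition LID: for $q\in\{1,2\}$, either (a) $\theta_0$ obeys Condition ES and $k(\theta_0,\ell_q)\ge s^{-1/q}\mu_n$; or (b) $\theta_0$ obeys Condition AS, $k(\theta_0(\epsilon),\ell_q)\ge s^{-1/q}\mu_n$ for $s=\lceil(A/\epsilon)^{1/a}\rceil$, and $\|G_j\|_1\le L_n$ for each $j\in[m]$. In case (b) of the theorem, $\epsilon=n^{-1/2}\ell_n(K+1)$ and $s=\lceil(A/\epsilon)^{1/a}\rceil$ accordingly. *)

(* Defs.v *)
From HB Require Import structures.
From mathcomp Require Import all_boot all_order all_algebra all_fingroup.
From mathcomp Require Import all_classical all_reals all_analysis.

Set Implicit Arguments.
Unset Strict Implicit.
Unset Printing Implicit Defensive.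
Import Order.TTheory GRing.Theory Num.Theory.
Import numFieldNormedType.Exports.

Local Open Scope classical_set_scope.
Local Open Scope ring_scope.

(* Vectors of R^k are columns 'cV[R]_k, and the rows G_j of G are `row j G`.
   On matrices, `|v| is the library's norm max_(i,j) `|v i j|, i.e. the
   l_infinity norm of a row or column vector. *)

Definition prob_at_least d (Omega : measurableType d) (R : realType)
    (P : probability Omega R) (c : R) (E : set Omega) : Prop :=
  (* E need not be measurable (minimizers are not assumed to be measurably
     selected); when it is, this says exactly that c <= P(E). *)
  exists B : set Omega, [/\ measurable B, B `<=` E & (c%:E <= P B)%E].

Section Vectors.
Variable R : realType.

Definition lq_norm (q : nat) (k l : nat) (v : 'M[R]_(k, l)) : R :=
  (\sum_(i < k) \sum_(j < l) `|v i j| ^+ q) `^ (q%:R^-1).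

Section Conditions.
Variable p : nat.
Implicit Types (Theta : set 'cV[R]_p) (theta eta : 'cV[R]_p).

Definition restricted_set Theta eta : set 'cV[R]_p :=
  [set theta | Theta theta /\ lq_norm 1 theta <= lq_norm 1 eta].

(* Extended-real valued, so that the infimum over the empty set is +oo. *)
Definition ident_factor m Theta (G : 'M[R]_(m, p)) (q : nat) eta : \bar R :=
  ereal_inf [set (`|G *m (theta - eta)| / lq_norm q (theta - eta))%:E |
     theta in [set theta | restricted_set Theta eta theta /\
                           0 < lq_norm q (theta - eta)]].

(* gh is one realization of the empirical moment function. *)
Definition is_RMD m Theta (gh : 'cV[R]_p -> 'cV[R]_m) (lambda : R) theta :=
  let feasible := [set t | Theta t /\ `|gh t| <= lambda] in
  Theta theta /\
  (feasible !=set0 ->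
   feasible theta /\
   forall t, feasible t -> lq_norm 1 theta <= lq_norm 1 t).

Definition cond_ES theta0 (s : nat) : Prop :=
  exists T : {set 'I_p}, #|T| = s /\ forall j, theta0 j 0 != 0 -> j \in T.

(* Indices are 0-based: entry j of the sorted sequence is |theta|*_(j+1). *)
Definition rearrangement theta (j : nat) : R :=
  nth 0 (sort (fun x y : R => y <= x) [seq `|theta i 0| | i <- enum 'I_p]) j.

Definition cond_AS (A a : R) theta0 : Prop :=
  [/\ 0 < A, 2^-1 < a &
      forall j : 'I_p, rearrangement theta0 j <= A * (j.+1%:R `^ (- a))].

Definition sparsity_level (A a eps : R) : nat :=
  `|Num.ceil ((A / eps) `^ (a^-1))|%N.

(* sigma lists the components of theta by non-increasing absolute value:
   position j.+1 in that order is held by component sigma j. *)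
Definition sorting_perm theta (sigma : 'S_p) : Prop :=
  forall i j : 'I_p, (i <= j)%N -> `|theta (sigma j) 0| <= `|theta (sigma i) 0|.

Definition discarded_mass (A a eps : R) (sigma : 'S_p) theta : R :=
  \sum_(j < p | A * (j.+1%:R `^ (- a)) <= eps) `|theta (sigma j) 0|.

Definition sparsification (A a eps : R) (sigma : 'S_p) theta : 'cV[R]_p :=
  \col_i
    (let j := (sigma^-1)%g i in
     if eps < A * (j.+1%:R `^ (- a))
     then theta i 0 + Num.sg (theta i 0) *
            (discarded_mass A a eps sigma theta /
             ((sparsity_level A a eps)%:R - 1))
     else 0).

Section Identification.
Variables (m : nat) (Theta : set 'cV[R]_p) (G : 'M[R]_(m, p)).

Definition cond_LIDa (mu : R) theta0 (s q : nat) : Prop :=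
  cond_ES theta0 s /\
  ((s%:R `^ (- q%:R^-1) * mu)%:E <= ident_factor Theta G q theta0)%E.

(* If several permutations sort theta0 (ties), any one of them may be used. *)
Definition cond_LIDb (L mu A a eps : R) theta0 (q : nat) : Prop :=
  [/\ cond_AS A a theta0,
      exists sigma : 'S_p, sorting_perm theta0 sigma /\
        (((sparsity_level A a eps)%:R `^ (- q%:R^-1) * mu)%:E <=
         ident_factor Theta G q (sparsification A a eps sigma theta0))%E &
      forall j : 'I_m, lq_norm 1 (row j G) <= L].

End Identification.
End Conditions.

Section Sampling.
Variables (d : measure_display) (Omega : measurableType d).
Variables (P : probability Omega R) (m p : nat).
Implicit Types (Theta : set 'cV[R]_p) (ghat : Omega -> 'cV[R]_p -> 'cV[R]_m).

Definition cond_L ghat (theta0 : 'cV[R]_p) (lambda alpha : R) : Prop :=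
  prob_at_least P (1 - alpha) [set w | `|ghat w theta0| <= lambda].

(* When 0 is outside Theta, g 0 and ghat w 0 are just the intercepts of the
   affine maps. *)
Definition cond_ELM Theta (G : 'M[R]_(m, p)) (g : 'cV[R]_p -> 'cV[R]_m) ghat
    (Ghat : Omega -> 'M[R]_(m, p)) (n : nat) (ell delta : R) : Prop :=
  (forall w theta, Theta theta ->
     ghat w theta = Ghat w *m theta + ghat w 0) /\
  prob_at_least P (1 - delta)
    [set w | Num.max
               (\big[Num.max/0]_(j < m) `|row j (Ghat w) - row j G|)
               `|ghat w 0 - g 0| <= ell / Num.sqrt n%:R].

End Sampling.
End Vectors.

(* Main.v *)
Require Import Defs.
From HB Require Import structures.
From mathcomp Require Import all_boot all_order all_algebra all_fingroup.
From mathcomp Require Import all_classical all_reals all_analysis.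
From mathcomp Require Import ring lra.

Set Implicit Arguments.
Unset Strict Implicit.
Unset Printing Implicit Defensive.
Import Order.TTheory GRing.Theory Num.Theory.
Import numFieldNormedType.Exports.

Local Open Scope classical_set_scope.
Local Open Scope ring_scope.

(** Fix a sample point at which both high-probability events hold. Then theta0
    is feasible for the minimization, so thetahat is feasible and satisfies
    |thetahat|_1 <= |theta0|_1 <= K. Since g is affine with g theta0 = 0, the
    vector G (thetahat - theta0) is g thetahat, and comparing it with the
    empirical moments costs lambda for feasibility, K ell / sqrt n for the slope
    and ell / sqrt n for the intercept: this is the bound (K + 2) ell / sqrt n of
    [RMD_moment_error]. By a union bound the two events hold together with
    probability at least 1 - alpha - delta ([prob_at_leastI]).

    In the exactly sparse case thetahat lies in the restricted set of theta0, and
    dividing by the identifiability factor gives the rate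
    ([exactly_sparse_error]).

    In the approximately sparse case the factor is only controlled at the
    sparsification eta of theta0. Moving the discarded mass onto the kept
    coordinates does not decrease the l_1 norm, so thetahat also lies in the
    restricted set of eta ([le_norm1_sparsification]). Writing c = a / (a - 1),
    the power tail estimate [powR_tail_sum] bounds the discarded mass by
    c eps s; hence eta is within 2 c eps of theta0 in sup norm and within
    4 c eps s^(1/q) in l_q norm ([sparsification_sup_error],
    [sparsification_lq_error]). The sup bound together with the l_1 bound L on the
    rows of G controls G (thetahat - eta), identifiability at eta turns this into
    a bound on thetahat - eta, and the triangle inequality concludes
    ([approximately_sparse_error]). The constant is C a q = 1 + 4 a / (a - 1). *)

(** * Norms of vectors and matrices *)

Section Norms.
Variable R : realType.

Lemma mx_norm_leP k l (v : 'M[R]_(k, l)) (c : R) : 0 <= c ->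
  `|v| <= c <-> forall i j, `|v i j| <= c.
Proof.
move=> c0; rewrite -[`|v|]/(mx_norm v) mx_normrE; split=> [/bigmax_leP[_ h] i j|h].
  exact: (h (i, j)).
by apply/bigmax_leP; split=> // -[i j] _; exact: h.
Qed.

Lemma ler_mx_entry k l (v : 'M[R]_(k, l)) i j : `|v i j| <= `|v|.
Proof. by apply: (mx_norm_leP v (normr_ge0 v)).1. Qed.

Lemma lq_norm_ge0 q k l (v : 'M[R]_(k, l)) : 0 <= lq_norm q v.
Proof. exact: powR_ge0. Qed.

Lemma lq_norm1E k l (v : 'M[R]_(k, l)) :
  lq_norm 1 v = \sum_i \sum_j `|v i j|.
Proof.
rewrite /lq_norm invr1 powRr1; last by do 2!apply: sumr_ge0 => ? _.
by under eq_bigr do under eq_bigr do rewrite expr1.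
Qed.

Lemma lq_norm_leE q k l (v : 'M[R]_(k, l)) (u : R) : (0 < q)%N -> 0 <= u ->
  (lq_norm q v <= u) = (\sum_i \sum_j `|v i j| ^+ q <= u ^+ q).
Proof.
move=> q0 u0; rewrite /lq_norm; set S := \sum_i _.
have S0 : 0 <= S by do 2!apply: sumr_ge0 => ? _; exact: exprn_ge0.
have q_neq0 : q%:R != 0 :> R by rewrite pnatr_eq0 -lt0n.
have uK : (u ^+ q) `^ q%:R^-1 = u.
  by rewrite -powR_mulrn// -powRrM mulfV// powRr1.
have SK : (S `^ q%:R^-1) ^+ q = S.
  by rewrite -powR_mulrn ?powR_ge0// -powRrM mulVf// powRr1.
apply/idP/idP => h; first by rewrite -SK lerXn2r// nnegrE powR_ge0.
by rewrite -uK ge0_ler_powR// ?invr_ge0// nnegrE exprn_ge0.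
Qed.

Lemma exprn_convex q (t x y : R) : (0 < q)%N -> 0 <= t <= 1 -> 0 <= x -> 0 <= y ->
  (t * x + (1 - t) * y) ^+ q <= t * x ^+ q + (1 - t) * y ^+ q.
Proof.
move=> q0 /andP[t0 t1] x0 y0.
have q1 : 1 <= q%:R :> R by rewrite ler1n.
have tI : Itv.spec (@Itv.num_sem R) (Itv.Real `[0%Z, 1%Z]) t.
  by rewrite /= /Itv.num_sem/= ger0_real//= in_itv/= t0 t1.
have := @convex_powR R _ q1 (Itv.mk tI) x y.
rewrite !inE/= !in_itv/= !andbT => /(_ x0 y0).
by rewrite !convRE/= !powR_mulrn// addr_ge0// mulr_ge0// subr_ge0.
Qed.

(** Minkowski's inequality for upper bounds u and v of the two norms. With
    t = u / (u + v), the sum x + y is (u + v) times the convex combination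
    t (x / u) + (1 - t) (y / v), and convexity of the q-th power bounds its q-th
    power entrywise. Strictly positive bounds, in place of the norms themselves,
    keep the normalization free of degenerate cases. *)
Lemma lq_normD_le q k l (x y : 'M[R]_(k, l)) (u v : R) : (0 < q)%N ->
  0 < u -> 0 < v -> lq_norm q x <= u -> lq_norm q y <= v ->
  lq_norm q (x + y) <= u + v.
Proof.
move=> q0 u0 v0; have uv0 : 0 < u + v by exact: addr_gt0.
have [u0' v0' uv0'] : [/\ 0 <= u, 0 <= v & 0 <= u + v] by split; exact: ltW.
rewrite !lq_norm_leE// => hx hy.
pose t := u / (u + v).
have t01 : 0 <= t <= 1.
  by rewrite divr_ge0//= ler_pdivrMr// mul1r lerDl.
have tC : 1 - t = v / (u + v) by rewrite /t; field; rewrite gt_eqF.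
have pt i j : `|(x + y) i j| ^+ q <=
    (u + v) ^+ q * (t / u ^+ q * `|x i j| ^+ q + (1 - t) / v ^+ q * `|y i j| ^+ q).
  apply: (@le_trans _ _
      (((u + v) * (t * (`|x i j| / u) + (1 - t) * (`|y i j| / v))) ^+ q)).
    rewrite lerXn2r// ?nnegrE//.
      by rewrite mulr_ge0// addr_ge0// mulr_ge0 ?divr_ge0// tC divr_ge0.
    rewrite mxE tC /t (le_trans (ler_normD _ _))// le_eqVlt; apply/orP; left.
    by apply/eqP; field; rewrite !gt_eqF.
  rewrite exprMn ler_wpM2l ?exprn_ge0//.
  apply: le_trans (exprn_convex q0 t01 (divr_ge0 _ _) (divr_ge0 _ _)) _ => //.
  by rewrite !expr_div_n -!mulrA ![_ ^-1 * _]mulrC.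
apply: (@le_trans _ _ ((u + v) ^+ q *
    (t / u ^+ q * (\sum_i \sum_j `|x i j| ^+ q) +
     (1 - t) / v ^+ q * (\sum_i \sum_j `|y i j| ^+ q)))).
  rewrite !mulr_sumr -big_split/= mulr_sumr; apply: ler_sum => i _.
  by rewrite !mulr_sumr -big_split/= mulr_sumr; apply: ler_sum => j _.
rewrite ger_pMr ?exprn_gt0//.
have /andP[t0 t1] := t01; rewrite -subr_ge0 in t1.
apply: (@le_trans _ _ (t / u ^+ q * u ^+ q + (1 - t) / v ^+ q * v ^+ q)).
  by rewrite lerD// ler_wpM2l// divr_ge0// exprn_ge0.
by rewrite !divfK ?expf_neq0 ?gt_eqF// addrC subrK.
Qed.

(** Splitting |x i j|^q as |x i j|^(q-1) |x i j| bounds the sum of q-th powers by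
    b^(q-1) times the l_1 norm, hence by b^q N. *)
Lemma lq_norm_interpolation q k l (x : 'M[R]_(k, l)) (b N : R) : (0 < q)%N ->
  0 <= b -> 0 <= N -> (forall i j, `|x i j| <= b) -> lq_norm 1 x <= b * N ->
  lq_norm q x <= b * N `^ (q%:R^-1).
Proof.
move=> q0 b0 N0 hb; rewrite lq_norm1E => h1.
rewrite lq_norm_leE ?mulr_ge0 ?powR_ge0//.
rewrite exprMn -(powR_mulrn _ (powR_ge0 _ _)) -powRrM mulVf ?pnatr_eq0 -?lt0n//.
rewrite powRr1// -(prednK q0) exprSr -mulrA.
apply: le_trans (ler_wpM2l _ h1); last exact: exprn_ge0.
rewrite mulr_sumr; apply: ler_sum => i _; rewrite mulr_sumr.
by apply: ler_sum => j _; rewrite exprSr ler_wpM2r// lerXn2r.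
Qed.

Lemma mulmx_norm_le1 m p (M : 'M[R]_(m, p)) (x : 'cV[R]_p) (r : R) : 0 <= r ->
  (forall i, `|row i M| <= r) -> `|M *m x| <= r * lq_norm 1 x.
Proof.
move=> r0 hM; apply/mx_norm_leP; first by rewrite mulr_ge0 ?lq_norm_ge0.
move=> i j; rewrite mxE lq_norm1E mulr_sumr (le_trans (ler_norm_sum _ _ _))//.
apply: ler_sum => k _; rewrite big_ord1 ord1 normrM ler_wpM2r//.
by have := le_trans (ler_mx_entry (row i M) 0 k) (hM i); rewrite mxE.
Qed.

Lemma mulmx_norm_lesup m p (M : 'M[R]_(m, p)) (x : 'cV[R]_p) (L : R) : 0 <= L ->
  (forall i, lq_norm 1 (row i M) <= L) -> `|M *m x| <= L * `|x|.
Proof.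
move=> L0 hM; apply/mx_norm_leP; first by rewrite mulr_ge0.
move=> i j; rewrite mxE (le_trans (ler_norm_sum _ _ _))//.
apply: le_trans (ler_wpM2r (normr_ge0 x) (hM i)).
rewrite lq_norm1E big_ord1 mulr_suml; apply: ler_sum => k _.
by rewrite normrM mxE ler_wpM2l// ler_mx_entry.
Qed.

End Norms.

(** * Tails of the series of powers j^(-a) *)

Section PowerTail.
Variable R : realType.

(** The integral test for x^(-a), made elementary: with y = i + 2, Bernoulli's
    inequality (1 - 1/y)^(1-a) >= 1 + (a - 1)/y, itself obtained from
    ln (1 - 1/y) <= - 1/y and 1 + u <= exp u, is multiplied by y^(1-a). *)
Lemma powR_telescope (a : R) (i : nat) : 1 < a ->
  (i.+2%:R : R) `^ (- a) <=
    (i.+1%:R `^ (1 - a) - i.+2%:R `^ (1 - a)) / (a - 1).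
Proof.
move=> a1; have a10 : 0 < a - 1 by rewrite subr_gt0.
set y : R := i.+2%:R; have y0 : 0 < y by rewrite ltr0n.
have y1 : 1 < y by rewrite ltr1n.
have xE : i.+1%:R = y * (1 - y^-1).
  by rewrite mulrBr mulr1 divff ?gt_eqF// /y -(natr1 i.+1) addrK.
have Vlt : y^-1 < 1 by rewrite invf_lt1.
rewrite ler_pdivlMr// lerBrDr xE powRM ?(ltW y0) ?subr_ge0 ?(ltW Vlt)//.
have -> : y `^ (- a) = y `^ (1 - a) * y^-1.
  rewrite -(powR_inv1 (ltW y0)) -powRD; last by rewrite (gt_eqF y0) implybT.
  by congr (_ `^ _); ring.
rewrite -mulrA [leLHS](_ : _ = y `^ (1 - a) * (1 + y^-1 * (a - 1))); last by ring.
rewrite ler_wpM2l ?powR_ge0// (le_trans (expR_ge1Dx _))//.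
rewrite /powR ifF ?gt_eqF ?subr_gt0// ler_expR.
have := @le_ln1Dx R (- y^-1); rewrite ltrN2 => /(_ Vlt) lnle.
have -> : 1 - a = - (a - 1) by ring.
by rewrite mulNr -mulrN mulrC ler_wpM2l ?(ltW a10)// lerNr.
Qed.

(** With s = k + 1 the first term is s^(-a) and the others telescope to at most
    s^(1-a) / (a - 1); bounding the first term by s^(-a) s gives the factor
    1 + 1 / (a - 1) = a / (a - 1). *)
Lemma powR_tail_sum (a : R) (k p : nat) : 1 < a ->
  \sum_(k <= j < p) (j.+1%:R : R) `^ (- a) <=
    k.+1%:R `^ (- a) * (k.+1%:R * (a / (a - 1))).
Proof.
move=> a1; have a10 : 0 < a - 1 by rewrite subr_gt0.
have aD : a / (a - 1) = 1 + (a - 1)^-1 by field; rewrite gt_eqF.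
have [pk|kp] := leqP p k.
  by rewrite big_geq// mulr_ge0 ?powR_ge0// mulr_ge0// aD addr_ge0// invr_ge0 ltW.
have tele i : \sum_(k <= j < k.+1 + i) (j.+1%:R : R) `^ (- a) <=
    k.+1%:R `^ (- a) +
    (k.+1%:R `^ (1 - a) - (k.+1 + i)%:R `^ (1 - a)) / (a - 1).
  elim: i => [|i ih]; first by rewrite addn0 big_nat1 subrr mul0r addr0.
  rewrite addnS big_nat_recr/=; last by rewrite addSn -addnS leq_addr.
  apply: le_trans (lerD ih (powR_telescope (k + i) a1)) _.
  rewrite -addrA -mulrDl lerD2l ler_wpM2r ?invr_ge0 ?(ltW a10)//.
  by rewrite !addSn; set u := _ `^ _; set v := _ `^ _; lra.
have := tele (p - k.+1)%N; rewrite (subnKC kp) => /le_trans; apply.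
have y0 : 0 < k.+1%:R :> R by rewrite ltr0n.
have -> : k.+1%:R `^ (1 - a) = k.+1%:R `^ (- a) * k.+1%:R :> R.
  by rewrite addrC powRD ?(gt_eqF y0) ?implybT// powRr1// ltW.
rewrite aD; set u := k.+1%:R `^ (- a).
have u0 : 0 <= u by exact: powR_ge0.
apply: (@le_trans _ _ (u + u * k.+1%:R / (a - 1))).
  by rewrite lerD2l ler_wpM2r ?invr_ge0 ?(ltW a10)// gerBl powR_ge0.
by rewrite !mulrDr mulr1 mulrA lerD2r ler_peMr// ler1n.
Qed.

End PowerTail.

(** * Sparsification of a vector with polynomially decaying entries *)

Section Sparsification.
Variable R : realType.

Lemma powR_lt_root (a x y : R) : 0 < a -> 0 <= x -> 0 <= y ->
  (y `^ a < x) = (y < x `^ a^-1).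
Proof.
move=> a0 x0 y0.
have rK z : 0 <= z -> (z `^ a) `^ a^-1 = z.
  by move=> z0; rewrite -powRrM mulfV ?gt_eqF// powRr1.
have Kr z : 0 <= z -> (z `^ a^-1) `^ a = z.
  by move=> z0; rewrite -powRrM mulVf ?gt_eqF// powRr1.
apply/idP/idP => h.
  by rewrite -[ltLHS]rK// gt0_ltr_powR ?invr_gt0// nnegrE powR_ge0.
by rewrite -[ltRHS]Kr// gt0_ltr_powR// nnegrE powR_ge0.
Qed.

(** The entry of 1-based rank j + 1 is kept exactly when j + 1 < (A / eps)^(1/a),
    which for an integer is the same as being below the ceiling. Thus s - 1
    ranks are kept. *)
Lemma lt_sparsity_level (A a eps : R) (j : nat) : 0 < A -> 0 < a -> 0 < eps ->
  (eps < A * j.+1%:R `^ (- a)) = (j.+1 < sparsity_level A a eps)%N.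
Proof.
move=> A0 a0 e0; rewrite /sparsity_level.
have x0 : 0 < (A / eps) `^ a^-1 by rewrite powR_gt0// divr_gt0.
rewrite -ltz_nat gez0_abs; last by rewrite ltW// ceil_gt0.
rewrite ceil_gt_int -[_%:~R]/(j.+1%:R).
rewrite -powR_lt_root// ?divr_ge0 ?(ltW A0) ?(ltW e0)//.
by rewrite powRN ltr_pdivlMr ?powR_gt0 ?ltr0n// [in RHS]ltr_pdivlMr// mulrC.
Qed.

Lemma sparsity_level_gt1 (A a eps : R) : 0 < a -> 0 < eps -> eps < A ->
  (1 < sparsity_level A a eps)%N.
Proof.
move=> a0 e0 eA; rewrite -lt_sparsity_level//; last exact: lt_trans eA.
by rewrite powR1 mulr1.
Qed.

(** A weakly decreasing list is unchanged by sorting, so any sorting permutation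
    lists the same values as the rearrangement, whichever way it breaks ties. *)
Lemma rearrangementE p (theta : 'cV[R]_p) (sigma : 'S_p) (j : 'I_p) :
  sorting_perm theta sigma -> rearrangement theta j = `|theta (sigma j) 0|.
Proof.
move=> hs; rewrite /rearrangement.
pose s := [seq `|theta (sigma i) 0| | i <- enum 'I_p].
have sz : size s = p by rewrite size_map size_enum_ord.
have geT : total (fun x y : R => y <= x) by move=> x y; exact: le_total.
have gtr : transitive (fun x y : R => y <= x).
  by move=> x y z h1 h2; exact: le_trans h2 h1.
have gas : antisymmetric (fun x y : R => y <= x).
  by move=> x y /andP[h1 h2]; apply/eqP; rewrite eq_le h1 h2.
have sE (i : 'I_p) : nth 0 s i = `|theta (sigma i) 0|.
  by rewrite (nth_map i) ?size_enum_ord// nth_ord_enum.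
suff -> : sort (fun x y : R => y <= x) [seq `|theta i 0| | i <- enum 'I_p] = s.
  exact: sE.
have ss : sorted (fun x y : R => y <= x) s.
  apply/(sortedP 0) => i; rewrite sz => ip.
  have ip' := ltnW ip.
  rewrite -[i]/(val (Ordinal ip')) -[i.+1]/(val (Ordinal ip)) !sE.
  exact/hs/leqnSn.
rewrite -(sorted_sort gtr ss); apply/(perm_sortP geT gtr gas).
rewrite /s (map_comp (fun i => `|theta i 0|) sigma); apply: perm_map.
apply: uniq_perm; rewrite ?(map_inj_uniq perm_inj) ?enum_uniq// => i.
by rewrite mem_enum -[i](permKV sigma) mem_map ?mem_enum//; exact: perm_inj.
Qed.

Lemma sum_ord_lt_le p k (t : R) : 0 <= t -> \sum_(j < p | (j < k)%N) t <= t * k%:R.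
Proof.
move=> t0; rewrite mulr_natr; have [kp|/ltnW pk] := leqP k p.
  by rewrite -(big_ord_widen p (fun=> t) kp) sumr_const card_ord.
rewrite (eq_bigl xpredT); last by move=> j; rewrite (leq_trans (ltn_ord j)).
by rewrite sumr_const card_ord ler_wpMn2l.
Qed.

Section PolynomialDecay.
Variables (p : nat) (A a eps : R) (sigma : 'S_p) (theta : 'cV[R]_p).
Hypotheses (a1 : 1 < a) (eps0 : 0 < eps) (epsA : eps < A).
Hypotheses (hsort : sorting_perm theta sigma) (hAS : cond_AS A a theta).

Let A0 : 0 < A. Proof. exact: lt_trans epsA. Qed.
Let a0 : 0 < a. Proof. exact: lt_trans a1. Qed.
Let k := (sparsity_level A a eps).-1.
Let mass := discarded_mass A a eps sigma theta.

Let levelE : sparsity_level A a eps = k.+1.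
Proof. by rewrite prednK// ltnW// sparsity_level_gt1. Qed.

Let k0 : (0 < k)%N.
Proof. by have := sparsity_level_gt1 a0 eps0 epsA; rewrite levelE. Qed.

Let kR0 : 0 < k%:R :> R. Proof. by rewrite ltr0n. Qed.

Let keptE (j : nat) : (eps < A * j.+1%:R `^ (- a)) = (j < k)%N.
Proof. by rewrite lt_sparsity_level// levelE. Qed.

Let discardedE (j : nat) : (A * j.+1%:R `^ (- a) <= eps) = (k <= j)%N.
Proof. by rewrite leNgt keptE -leqNgt. Qed.

Let massE : mass = \sum_(j < p | (k <= j)%N) `|theta (sigma j) 0|.
Proof. by apply: eq_bigl => j; rewrite discardedE. Qed.

Let mass_ge0 : 0 <= mass. Proof. by rewrite massE sumr_ge0. Qed.

Let decay (j : 'I_p) : `|theta (sigma j) 0| <= A * j.+1%:R `^ (- a).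
Proof. by rewrite -rearrangementE//; case: hAS. Qed.

(** The discarded ranks start at s, where A s^(-a) <= eps by definition of s, so
    in the bound A s^(-a) s a / (a - 1) of the tail the first two factors are
    replaced by eps. *)
Lemma discarded_mass_le :
  mass <= eps * ((sparsity_level A a eps)%:R * (a / (a - 1))).
Proof.
rewrite massE (le_trans (ler_sum _ (fun j _ => decay j)))//.
rewrite levelE -mulr_sumr -(big_geq_mkord _ _ xpredT (fun j => j.+1%:R `^ (- a))).
apply: le_trans (ler_wpM2l (ltW A0) (powR_tail_sum k p a1)) _.
rewrite [leLHS]mulrA ler_wpM2r ?discardedE// mulr_ge0// divr_ge0 ?(ltW a0)//.
by rewrite subr_ge0 ltW.
Qed.

(** The factor 2 comes from s <= 2 (s - 1), valid because s >= 2. *)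
Lemma redistributed_mass_le : mass / k%:R <= 2 * (a / (a - 1)) * eps.
Proof.
rewrite ler_pdivrMr// (le_trans discarded_mass_le)// levelE.
have c0 : 0 <= a / (a - 1) by rewrite divr_ge0 ?(ltW a0)// subr_ge0 ltW.
have kS : k.+1%:R <= 2 * k%:R :> R.
  by rewrite -natrM ler_nat mul2n -addnn -addn1 leq_add2l.
rewrite [leRHS](_ : _ = eps * (2 * k%:R * (a / (a - 1)))); last by ring.
by rewrite ler_wpM2l ?(ltW eps0)// ler_wpM2r.
Qed.

Let sparsE (j : 'I_p) :
  sparsification A a eps sigma theta (sigma j) 0 =
  if (j < k)%N then
    theta (sigma j) 0 + Num.sg (theta (sigma j) 0) * (mass / k%:R)
  else 0.
Proof. by rewrite mxE /= permK keptE levelE -(natr1 k) addrK. Qed.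

Let norm1E (v : 'cV[R]_p) : lq_norm 1 v = \sum_j `|v (sigma j) 0|.
Proof.
rewrite lq_norm1E (reindex_inj (@perm_inj _ sigma)).
by apply: eq_bigr => j _; rewrite big_ord1.
Qed.

(** If some mass is discarded, then a nonzero entry has rank at least s, so by
    sorting all s - 1 kept entries are nonzero; each of them grows in absolute
    value by its full share of the mass, and the shares add up to what was
    removed. *)
Lemma le_norm1_sparsification :
  lq_norm 1 theta <= lq_norm 1 (sparsification A a eps sigma theta).
Proof.
rewrite !norm1E (bigID (fun j : 'I_p => (j < k)%N))/=.
rewrite [leRHS](bigID (fun j : 'I_p => (j < k)%N))/=.
under [X in _ + X <= _]eq_bigl do rewrite -leqNgt.
rewrite -massE [X in _ <= _ + X]big1 ?addr0; last first.
  by move=> j /negbTE jk; rewrite sparsE jk normr0.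
have [m0|m_neq0] := eqVneq mass 0.
  rewrite m0 addr0; apply: ler_sum => j jk.
  by rewrite sparsE jk m0 mul0r mulr0 addr0.
have [j0 kj0 tj0] : exists2 j0 : 'I_p, (k <= j0)%N & theta (sigma j0) 0 != 0.
  have [//|none] := pselect (exists2 j0 : 'I_p, (k <= j0)%N & theta (sigma j0) 0 != 0).
  case/eqP: m_neq0; rewrite massE big1// => j kj; apply/eqP.
  rewrite normr_eq0; apply/negPn/negP => tj; apply: none; by exists j.
have kp : (k <= p)%N by rewrite (leq_trans kj0)// ltnW.
have -> : mass = \sum_(j < p | (j < k)%N) mass / k%:R.
  rewrite -(big_ord_widen p (fun=> mass / k%:R) kp) sumr_const card_ord.
  by rewrite -[RHS]mulr_natr divfK// gt_eqF.
rewrite -big_split/=; apply: ler_sum => j jk; rewrite sparsE jk.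
have tj : theta (sigma j) 0 != 0.
  rewrite -normr_gt0 (lt_le_trans _ (hsort (leq_trans (ltnW jk) kj0)))//.
  by rewrite normr_gt0.
rewrite {2}[theta (sigma j) 0]numEsg -mulrDr normrM normr_sg tj mul1r.
by rewrite ger0_norm// addr_ge0// divr_ge0.
Qed.

Let diffE (j : 'I_p) :
  `|(sparsification A a eps sigma theta - theta) (sigma j) 0| <=
  if (j < k)%N then mass / k%:R else `|theta (sigma j) 0|.
Proof.
rewrite mxE sparsE mxE; case: ifP => _; last by rewrite sub0r normrN.
rewrite addrC addKr normrM [X in _ * X]ger0_norm ?divr_ge0//.
by rewrite ler_piMl ?divr_ge0// normr_sg lern1 leq_b1.
Qed.

(** A kept entry moves by at most its share of the discarded mass, and a
    discarded entry was at most A j^(-a) <= eps. *)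
Lemma sparsification_sup_error :
  `|sparsification A a eps sigma theta - theta| <= 2 * (a / (a - 1)) * eps.
Proof.
have c1 : 1 <= a / (a - 1).
  by rewrite ler_pdivlMr ?subr_gt0// mul1r gerBl.
apply/mx_norm_leP.
  by rewrite mulr_ge0 ?(ltW eps0)// mulr_ge0// (le_trans _ c1).
move=> i j; rewrite ord1 -[i](permKV sigma); move: (_ i) => {}i.
apply: le_trans (diffE i) _; case: ifP => [_|/negbT].
  exact: redistributed_mass_le.
rewrite -leqNgt -discardedE => /(le_trans (decay i))/le_trans; apply.
by rewrite ler_peMl ?(ltW eps0)//; lra.
Qed.

(** The l_1 error is at most twice the discarded mass: once for the removed
    entries and once for the redistribution. The l_q bound follows by
    interpolation with the sup norm. *)
Lemma sparsification_lq_error q : (0 < q)%N ->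
  lq_norm q (sparsification A a eps sigma theta - theta) <=
  4 * (a / (a - 1)) * eps * (sparsity_level A a eps)%:R `^ (q%:R^-1).
Proof.
move=> q0.
have c0 : 0 <= a / (a - 1) by rewrite divr_ge0 ?(ltW a0)// subr_ge0 ltW.
have ce0 : 0 <= a / (a - 1) * eps by rewrite mulr_ge0// ltW.
apply: lq_norm_interpolation => //.
- by rewrite -mulrA mulr_ge0.
- move=> i j; apply: le_trans (ler_mx_entry _ i j) _.
  by apply: le_trans sparsification_sup_error _; rewrite -!mulrA; lra.
rewrite norm1E (le_trans (ler_sum _ (fun j _ => diffE j)))//.
rewrite (bigID (fun j : 'I_p => (j < k)%N))/=.
rewrite (eq_bigr (fun=> mass / k%:R)); last by move=> j ->.
rewrite [X in _ + X](eq_bigr (fun j => `|theta (sigma j) 0|)); last first.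
  by move=> j /negbTE->.
under [X in _ + X <= _]eq_bigl do rewrite -leqNgt.
rewrite -massE.
have := sum_ord_lt_le p k (divr_ge0 mass_ge0 (ltW kR0)).
rewrite divfK ?gt_eqF// => h1.
have h2 := discarded_mass_le.
apply: le_trans (lerD h1 (lexx mass)) _.
apply: le_trans (lerD h2 h2) _; rewrite levelE.
have : 0 <= a / (a - 1) * eps * k.+1%:R by rewrite mulr_ge0.
set c := a / (a - 1); set z := k.+1%:R.
by rewrite [eps * _](_ : _ = c * eps * z); [lra|ring].
Qed.

End PolynomialDecay.
End Sparsification.

(** * Intersection of two high-probability events *)

Lemma prob_at_leastI d (Omega : measurableType d) (R : realType)
    (P : probability Omega R) (alpha delta : R) (E F H : set Omega) :
  prob_at_least P (1 - alpha) E -> prob_at_least P (1 - delta) F ->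
  E `&` F `<=` H -> prob_at_least P (1 - alpha - delta) H.
Proof.
move=> [B [mB BE PB]] [D [mD DF PD]] EFH; exists (B `&` D); split.
- exact: measurableI.
- by move=> w [Bw Dw]; apply: EFH; split; [exact: BE|exact: DF].
have PC : (P (B `\` D) <= 1 - P D)%E.
  rewrite -probability_setC//; apply: le_measure; rewrite ?inE.
  - exact: measurableD.
  - exact: measurableC.
  - by move=> w [].
have fin X : measurable X -> P X \is a fin_num by exact: fin_num_measure.
have mBD := measurableD mB mD; have mBI := measurableI _ _ mB mD.
have split_B : fine (P B) = fine (P (B `\` D)) + fine (P (B `&` D)).
  by rewrite -fineD ?fin//; congr fine; exact: measureDI.
move: PB PD PC; rewrite -(fineK (fin _ mB)) -(fineK (fin _ mD)).
rewrite -(fineK (fin _ mBD)) -(fineK (fin _ mBI)) -EFinB !lee_fin => h1 h2 h3.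
by lra.
Qed.

(** * Error bounds at a fixed sample point *)

Section Recovery.
Variable R : realType.

Lemma ident_factor_error q m p (Theta : set 'cV[R]_p) (G : 'M[R]_(m, p))
    (eta theta : 'cV[R]_p) (s : nat) (mu b : R) :
  (0 < s)%N -> 0 < mu ->
  ((s%:R `^ (- q%:R^-1) * mu)%:E <= ident_factor Theta G q eta)%E ->
  restricted_set Theta eta theta -> `|G *m (theta - eta)| <= b ->
  lq_norm q (theta - eta) <= b / mu * s%:R `^ (q%:R^-1).
Proof.
move=> s0 mu0 hk hr hb.
have S0 : 0 < s%:R `^ (q%:R^-1) :> R by rewrite powR_gt0// ltr0n.
have [N0|] := ltP 0 (lq_norm q (theta - eta)); last first.
  move=> /le_trans; apply; rewrite mulr_ge0 ?(ltW S0)// divr_ge0 ?(ltW mu0)//.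
  exact: le_trans hb.
have : (ident_factor Theta G q eta <=
    (`|G *m (theta - eta)| / lq_norm q (theta - eta))%:E)%E.
  by apply: ereal_inf_lbound; exists theta.
move=> /(le_trans hk); rewrite lee_fin ler_pdivlMr// => /le_trans/(_ hb).
move=> h; rewrite powRN -mulrA mulrC ler_pdivrMr// in h.
by rewrite mulrAC ler_pdivlMr// mulrC.
Qed.

Lemma cond_ES0 p (theta : 'cV[R]_p) : cond_ES theta 0 -> theta = 0.
Proof.
case=> T [/eqP]; rewrite cards_eq0 => /eqP-> hT; apply/matrixP => i j.
rewrite mxE ord1; apply/eqP; apply: contraT => /hT.
by rewrite finset.in_set0.
Qed.

(** Feasibility of theta0 makes theta feasible and of smaller l_1 norm. The three
    terms of r (K + 2) bound, in the decomposition
    G (theta - theta0) = gh theta + (G - Gh) theta - (gh 0 - g 0),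
    the empirical moment, the slope error and the intercept error. *)
Lemma RMD_moment_error m p (Theta : set 'cV[R]_p) (theta0 theta : 'cV[R]_p)
    (G Gh : 'M[R]_(m, p)) (g gh : 'cV[R]_p -> 'cV[R]_m) (lambda K r : R) :
  (forall t, Theta t -> g t = G *m t + g 0) ->
  (forall t, Theta t -> gh t = Gh *m t + gh 0) ->
  Theta theta0 -> g theta0 = 0 -> lq_norm 1 theta0 <= K -> lambda <= r ->
  is_RMD Theta gh lambda theta -> `|gh theta0| <= lambda ->
  (forall j, `|row j Gh - row j G| <= r) -> `|gh 0 - g 0| <= r ->
  restricted_set Theta theta0 theta /\
  `|G *m (theta - theta0)| <= r * (K + 2).
Proof.
move=> gE ghE T0 g0 hK lr [T1 hRMD] l0 hG hc.
have [|[_ f1] hmin] := hRMD; first by exists theta0.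
have n1 := hmin _ (conj T0 l0); split=> //.
have r0 : 0 <= r by exact: le_trans hc.
have -> : G *m (theta - theta0) =
    gh theta + ((G - Gh) *m theta + - (gh 0 - g 0)).
  rewrite mulmxBr mulmxBl (ghE _ T1).
  have /eqP := gE _ T0; rewrite g0 eq_sym addr_eq0 => /eqP->.
  by apply/matrixP => i j; rewrite !mxE; ring.
have hM : `|(G - Gh) *m theta| <= r * lq_norm 1 theta.
  by apply: mulmx_norm_le1 => // i; rewrite linearB/= distrC.
have hM' : r * lq_norm 1 theta <= r * K.
  by rewrite ler_wpM2l// (le_trans n1).
have := ler_normD (gh theta) ((G - Gh) *m theta + - (gh 0 - g 0)).
have := ler_normD ((G - Gh) *m theta) (- (gh 0 - g 0)).
by rewrite normrN mulrDr; lra.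
Qed.

Lemma exactly_sparse_error q m p (Theta : set 'cV[R]_p) (G : 'M[R]_(m, p))
    (theta0 theta : 'cV[R]_p) (s : nat) (mu b : R) :
  (0 < q)%N -> 0 < mu -> cond_LIDa Theta G mu theta0 s q ->
  restricted_set Theta theta0 theta -> `|G *m (theta - theta0)| <= b ->
  lq_norm q (theta - theta0) <= b / mu * s%:R `^ (q%:R^-1).
Proof.
move=> q0 mu0 [hES hk] hr hb; case: s hES hk => [|s] hES hk; last first.
  exact: ident_factor_error hk hr hb.
(* For s = 0 the factor 0^(-1/q) vanishes and identifiability says nothing, but
   then theta0 = 0 and the l_1 constraint forces theta = 0. *)
have t0 := cond_ES0 hES; case: hr => _; rewrite t0 subr0 => n1.
have n0 : lq_norm 1 theta <= `|theta| * 0.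
  rewrite mulr0 (le_trans n1)// lq_norm1E big1// => i _.
  by rewrite big1// => j _; rewrite mxE normr0.
have := lq_norm_interpolation q0 (normr_ge0 _) (lexx 0) (ler_mx_entry theta) n0.
by rewrite powR0 ?invr_eq0 ?pnatr_eq0 -?lt0n// !mulr0.
Qed.

(** The sparsification serves as the centre: identifiability bounds the distance
    from theta to it, and the sparsification error brings the bound back to
    theta0. The extra term in L is the price of G (eta - theta0). *)
Lemma approximately_sparse_error q m p (Theta : set 'cV[R]_p) (G : 'M[R]_(m, p))
    (theta0 theta : 'cV[R]_p) (A a eps L mu b : R) :
  (0 < q)%N -> 1 < a -> 0 < eps -> eps < A -> 0 < L -> 0 < mu -> 0 < b ->
  cond_LIDb Theta G L mu A a eps theta0 q ->
  restricted_set Theta theta0 theta -> `|G *m (theta - theta0)| <= b ->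
  lq_norm q (theta - theta0) <=
    ((b + L * (2 * (a / (a - 1)) * eps)) / mu + 4 * (a / (a - 1)) * eps) *
    (sparsity_level A a eps)%:R `^ (q%:R^-1).
Proof.
move=> q0 a1 e0 eA L0 mu0 b0 [hAS [sigma [hs hk]] hL] [T1 n1] hb.
set eta := sparsification A a eps sigma theta0 in hk *.
set S := _ `^ _.
have a0 : 0 < a by exact: lt_trans a1.
have s0 : (0 < sparsity_level A a eps)%N.
  by rewrite ltnW// sparsity_level_gt1.
have S0 : 0 < S by rewrite powR_gt0// ltr0n.
have c0 : 0 < a / (a - 1) by rewrite divr_gt0// subr_gt0.
have hr : restricted_set Theta eta theta.
  split=> //; apply: le_trans n1 _.
  exact: (le_norm1_sparsification a1 e0 eA hs).
have hGe : `|G *m (theta - eta)| <= b + L * (2 * (a / (a - 1)) * eps).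
  rewrite -(subrKA theta0) mulmxDr (le_trans (ler_normD _ _))// lerD//.
  rewrite -opprB mulmxN normrN (le_trans (mulmx_norm_lesup _ (ltW L0) hL))//.
  by rewrite ler_wpM2l ?(ltW L0)//; exact: sparsification_sup_error.
have hu := ident_factor_error s0 mu0 hk hr hGe.
have hv := sparsification_lq_error a1 e0 eA hs hAS q0.
rewrite -/eta -/S in hu hv.
have ce0 : 0 < a / (a - 1) * eps by exact: mulr_gt0.
rewrite -(subrKA eta) mulrDl; apply: lq_normD_le => //.
  rewrite mulr_gt0// divr_gt0// addr_gt0// mulr_gt0//.
  by rewrite -mulrA mulr_gt0.
by rewrite mulr_gt0// -mulrA mulr_gt0.
Qed.

End Recovery.

Theorem theorem3p1 (R : realType) :
  exists C : R -> nat -> R,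
  forall (d : measure_display) (Omega : measurableType d)
    (P : probability Omega R) (n m p : nat)
    (Theta : set 'cV[R]_p) (theta0 : 'cV[R]_p)
    (G : 'M[R]_(m, p)) (g : 'cV[R]_p -> 'cV[R]_m)
    (Ghat : Omega -> 'M[R]_(m, p)) (ghat : Omega -> 'cV[R]_p -> 'cV[R]_m)
    (thetahat : Omega -> 'cV[R]_p)
    (alpha lambda delta ell L mu K : R) (s : nat) (A a : R),
  let eps := ell * (K + 1) / Num.sqrt n%:R in
  (0 < n)%N -> 0 < alpha < 1 -> 0 < lambda -> 0 < delta ->
  1 <= ell -> 1 <= L -> 0 < mu -> 0 < K ->
  (forall theta, Theta theta -> g theta = G *m theta + g 0) ->
  Theta theta0 -> g theta0 = 0 ->
  (forall theta, Theta theta -> g theta = 0 -> theta = theta0) ->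
  (forall theta, Theta theta ->
     forall j, measurable_fun setT (fun w => ghat w theta j 0)) ->
  (forall w, is_RMD Theta (ghat w) lambda (thetahat w)) ->
  cond_L P ghat theta0 lambda alpha ->
  lq_norm 1 theta0 <= K ->
  cond_ELM P Theta G g ghat Ghat n ell delta ->
  lambda <= ell / Num.sqrt n%:R ->
  prob_at_least P (1 - alpha - delta)
    [set w | forall q : nat, q = 1%N \/ q = 2%N ->
       (cond_LIDa Theta G mu theta0 s q ->
        lq_norm q (thetahat w - theta0) <=
          ell * (K + 2) * s%:R `^ (q%:R^-1) / (mu * Num.sqrt n%:R))
       /\
       (1 < a -> eps < A -> cond_LIDb Theta G L mu A a eps theta0 q ->
        lq_norm q (thetahat w - theta0) <=
          C a q * (L + mu) * ell * (K + 2) *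
            (sparsity_level A a eps)%:R `^ (q%:R^-1) /
          (mu * Num.sqrt n%:R))].
Proof.
exists (fun a _ => 1 + 4 * (a / (a - 1))).
move=> d Omega P n m p Theta theta0 G g Ghat ghat thetahat alpha lambda delta
  ell L mu K s A a eps n0 _ _ _ ell1 L1 mu0 K0 gE T0 g0 _ _ hRMD hL hK
  [ghE hELM] lr.
have rn0 : 0 < Num.sqrt (n%:R : R) by rewrite sqrtr_gt0 ltr0n.
have ell0 : 0 < ell by exact: lt_le_trans ell1.
have L0 : 0 < L by exact: lt_le_trans L1.
have eps0 : 0 < eps by rewrite divr_gt0// mulr_gt0// addr_gt0.
apply: (prob_at_leastI hL hELM) => w [/= hL0].
rewrite ge_max => /andP[/bigmax_leP[_ hrow] hint] q q12.
have q0 : (0 < q)%N by case: q12 => ->.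
have [hr hb] := RMD_moment_error gE (ghE w) T0 g0 hK lr (hRMD w) hL0
  (fun j => hrow j isT) hint.
have b0 : 0 < ell / Num.sqrt n%:R * (K + 2).
  by rewrite mulr_gt0 ?divr_gt0// addr_gt0.
split=> [hLID|a1 eA hLID].
  apply: le_trans (exactly_sparse_error q0 mu0 hLID hr hb) _.
  by rewrite le_eqVlt; apply/orP; left; apply/eqP; field; rewrite !gt_eqF.
apply: le_trans
  (approximately_sparse_error q0 a1 eps0 eA L0 mu0 b0 hLID hr hb) _.
have c0 : 0 < a / (a - 1) by rewrite divr_gt0 ?subr_gt0// (lt_trans _ a1).
set S := _ `^ _; have S0 : 0 <= S by exact: powR_ge0.
move: c0 S0; rewrite /eps; move: (a / (a - 1)) S => c S c0 S0.
have nz : (mu != 0) * (Num.sqrt (n%:R : R) != 0) by rewrite !gt_eqF.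
set r := Num.sqrt n%:R in rn0 nz *.
(* After dividing by the common factor the comparison is a polynomial one, in
   which the leading K + 2 is absorbed by L >= 1. *)
rewrite [leLHS](_ : _ = ell * S / (mu * r) *
  ((K + 2) + 2 * c * L * (K + 1) + 4 * c * (K + 1) * mu)); last first.
  by field; rewrite !nz.
rewrite [leRHS](_ : _ = ell * S / (mu * r) *
  ((1 + 4 * c) * (L + mu) * (K + 2))); last by field; rewrite !nz.
apply: ler_wpM2l; first by rewrite divr_ge0// mulr_ge0// ltW.
have cL : 0 <= c * L by rewrite mulr_ge0 ?ltW.
have cm : 0 <= c * mu by rewrite mulr_ge0 ?ltW.
have cLK : 0 <= c * L * K by rewrite mulr_ge0// ltW.
have mK : 0 <= mu * K by rewrite mulr_ge0 ?ltW.
have LK : 0 <= (L - 1) * (K + 2) by rewrite mulr_ge0 ?subr_ge0// addr_ge0// ltW.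
nra.
Qed.
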